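(* As $n \to \infty$, \[\operatorname{ssp}(K_n) = (1 + o(1))n.\]
   Context: For a graph $G$, a family $\mathcal{P}$ of paths in $G$ is strong-separating if for every ordered pair of distinct edges $e,f$ of $G$ there is a path in $\mathcal{P}$ containing $e$ but not $f$. $\operatorname{ssp}(G)$ denotes the minimum size of a strong-separating family of paths in $G$. $K_n$ is the complete graph on $n$ vertices. *)

(* Defs.v *)
From Stdlib Require Import ClassicalEpsilon.
From mathcomp Require Import all_boot all_order all_algebra.
Set Implicit Arguments. Unset Strict Implicit. Unset Printing Implicit Defensive.

(* A simple graph on a finite vertex type T is given by its adjacency
   relation G (assumed symmetric and irreflexive where relevant). *)

Definition gedges (T : finType) (G : rel T) : {set {set T}} :=
  [set [set x; y] | x in T, y in T & G x y && (x != y)].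

Definition gpath (T : finType) (G : rel T) (s : seq T) : bool :=
  uniq s && (if s is x :: t then path G x t else true).

Definition pedges (T : finType) (s : seq T) : {set {set T}} :=
  [set [set p.1; p.2] | p in zip s (behead s)].

Definition strong_separating (T : finType) (G : rel T) (F : seq (seq T)) : Prop :=
  (forall s, s \in F -> gpath G s) /\
  (forall e f, e \in gedges G -> f \in gedges G -> e != f ->
     exists2 s, s \in F & (e \in pedges s) && (f \notin pedges s)).

Definition Kn (n : nat) : rel 'I_n := fun x y => x != y.
Arguments Kn n : clear implicits.

Definition classb (P : Prop) : bool :=
  if excluded_middle_informative P then true else false.

Lemma classbP (P : Prop) : reflect P (classb P).
Proof. by rewrite /classb; case: excluded_middle_informative => h; constructor. Qed.

(* Existence of a strong-separating family for K_n: one single-edge path per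
   (ordered) adjacent pair. *)
Lemma ssp_Kn_exists (n : nat) :
  exists k, classb (exists F : seq (seq 'I_n),
                      size F = k /\ strong_separating (Kn n) F).
Proof.
set F := [seq [:: p.1; p.2] | p <- enum [set p : 'I_n * 'I_n | p.1 != p.2]].
exists (size F); apply/classbP; exists F; split=> //; split.
  move=> s /mapP [p]; rewrite mem_enum inE => hp ->.
  by rewrite /gpath /= inE hp /Kn /= hp.
move=> e f /imset2P [x y _]; rewrite !inE /= => /andP [hxy _] -> _ hne.
exists [:: x; y]; first by apply/mapP; exists (x, y) => //; rewrite mem_enum inE.
have -> : pedges [:: x; y] = [set [set x; y]].
  apply/setP => z; rewrite inE; apply/imsetP/eqP => [[p] | ->].
    by rewrite inE => /eqP -> ->.
  by exists (x, y) => //; rewrite inE.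
by rewrite !inE eqxx /= eq_sym.
Qed.

Definition ssp_K (n : nat) : nat := ex_minn (ssp_Kn_exists n).

(* Main.v *)
Require Import Defs.
From mathcomp Require Import all_boot all_order all_algebra.
From mathcomp Require Import ring zify.
Import Order.TTheory GRing.Theory Num.Theory.
Set Implicit Arguments. Unset Strict Implicit. Unset Printing Implicit Defensive.

(** Lower bound: an edge on a single path of the family must be the whole path,
    so, counting one-edge paths twice, the paths cover every edge twice; since a
    path has at most [n - 1] edges there are at least [n] paths.

    Upper bound: write [n = m + c] with [m = 1 mod 6] and [c < 6], and let
    [Z/m] act on [Z/m] together with [c] fixed points. If a base path consisted
    of the edges [{x, 2x}] for all [x], its two edges of difference [x] up to
    sign, [{x, 2x}] and [{-x, -2x}], would be translates of each other by [3x];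
    as [3x] determines [x], two translates of the path would share at most one
    edge and every edge would be the intersection of two of the [m] translates.
    The orbits of doubling are concatenated greedily into one path: short orbits
    are few, so only a small proportion of the steps are not doublings, and the
    link from [u] to [v] is chosen so that the [v - u] are distinct up to sign.
    This spoils only few differences. The vertices [2 * 4 ^ j] of the path are
    replaced by the fixed points. The edges with a spoiled difference form a
    graph of small maximum degree, which is separated by [o(n)] further paths. *)

(** * Separating a sparse graph *)

(** The set [f] ranges over all vertex sets, not only over edges of some graph, so the property of a
    single edge survives any enlargement of the family. *)
Definition separates (T : finType) (F : seq (seq T)) (e : {set T}) : Prop :=
  forall f, f != e -> exists2 s, s \in F & (e \in pedges s) && (f \notin pedges s).

Lemma pedgesP (T : finType) (s : seq T) (e : {set T}) :
  reflect (exists x y, (x, y) \in zip s (behead s) /\ e = [set x; y]) (e \in pedges s).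
Proof.
apply: (iffP imsetP) => [[[x y] /= h ->]|[x [y [h ->]]]].
  by exists x, y; split.
by exists (x, y).
Qed.

Lemma pedges_cons2 (T : finType) (x y : T) (s : seq T) :
  pedges [:: x, y & s] = [set x; y] |: pedges (y :: s).
Proof.
apply/setP => e; rewrite in_setU1; apply/pedgesP/orP.
  move=> [a [b [/= ]]]; rewrite inE => /orP [/eqP [-> ->] ->|h ->]; first by left.
  by right; apply/pedgesP; exists a, b.
move=> [/eqP ->|/pedgesP [a [b [h ->]]]]; first by exists x, y; rewrite inE eqxx.
by exists a, b; rewrite inE h orbT.
Qed.

Lemma zip_behead_mem (T : eqType) (s : seq T) (x y : T) :
  (x, y) \in zip s (behead s) -> (x \in s) && (y \in s).
Proof.
elim: s => [|a [|b s] IH] //=.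
rewrite inE => /orP [/eqP [-> ->]|/IH]; first by rewrite !inE eqxx /= eqxx orbT.
by case/andP => hx hy; rewrite !(in_cons a) hx hy !orbT.
Qed.

Lemma pedges_sub (T : finType) (s : seq T) (e : {set T}) :
  e \in pedges s -> {subset e <= s}.
Proof.
move=> /pedgesP [x [y [/zip_behead_mem /andP [hx hy] ->]]] z.
by rewrite !inE => /orP [] /eqP ->.
Qed.

Lemma zip_behead_neq (T : eqType) (s : seq T) (x y : T) :
  uniq s -> (x, y) \in zip s (behead s) -> x != y.
Proof.
elim: s => [|a [|b s] IH] //= /andP [ha hu].
rewrite inE => /orP [/eqP [-> ->]|]; last exact: IH.
by apply: contraNneq ha => ->; rewrite inE eqxx.
Qed.

Lemma card_pedges (T : finType) (s : seq T) : #|pedges s| <= (size s).-1.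
Proof.
apply: leq_trans (leq_imset_card _ _) _; apply: leq_trans (card_size _) _.
by rewrite size_zip size_behead geq_minr.
Qed.

(** In a complete graph a matching, listed as ordered pairs, is traversed by one path; reversing
    every pair gives a second path with the same matching edges but other links. *)
Definition unpair (T : Type) (ps : seq (T * T)) : seq T :=
  flatten [seq [:: p.1; p.2] | p <- ps].

Definition swap (T : Type) (p : T * T) := (p.2, p.1).

Lemma mem_unpair_swap (T : eqType) (ps : seq (T * T)) :
  unpair (map (@swap T) ps) =i unpair ps.
Proof.
elim: ps => [|p ps IH] x //.
by rewrite /unpair /= !inE -!/(unpair _) IH !orbA [_ || (_ == p.1)]orbC.
Qed.

Lemma unpair_swap_uniq (T : eqType) (ps : seq (T * T)) :
  uniq (unpair (map (@swap T) ps)) = uniq (unpair ps).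
Proof.
elim: ps => [|p ps IH] //.
rewrite /unpair /= !inE -!/(unpair _) IH !mem_unpair_swap eq_sym.
by case: (p.1 == p.2) => //=; rewrite !andbA [(p.2 \notin _) && _]andbC.
Qed.

Lemma pedges_unpair (T : finType) (ps : seq (T * T)) (p : T * T) :
  p \in ps -> [set p.1; p.2] \in pedges (unpair ps).
Proof.
elim: ps => [|q ps IH] //; rewrite inE /unpair /= -/(unpair ps).
rewrite pedges_cons2 => /orP [/eqP ->|/IH]; first exact: setU11.
case: (unpair ps) => [|r s] h; first by case/pedgesP: h => ? [? []].
by rewrite pedges_cons2 !in_setU1 h !orbT.
Qed.

(* A linking edge of the first path and one of the second path that join the
   same two consecutive pairs are disjoint. *)
Lemma pedges_unpair_swap (T : finType) (ps : seq (T * T)) (e : {set T}) :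
  uniq (unpair ps) -> e \in pedges (unpair ps) ->
  e \in pedges (unpair (map (@swap T) ps)) ->
  exists2 p, p \in ps & e = [set p.1; p.2].
Proof.
elim: ps => [|p [|q ps] IH] //.
- by move=> _ /pedgesP [? [? []]].
- rewrite /unpair /= !pedges_cons2 => _.
  rewrite in_setU1 => /orP [/eqP -> _|/pedgesP [? [? []]] //].
  by exists p; rewrite ?mem_head.
have Emem := mem_unpair_swap (q :: ps).
have EE r r' (l : seq (T * T)) : pedges (unpair [:: r, r' & l]) =
    [set r.1; r.2] |: ([set r.2; r'.1] |: pedges (unpair (r' :: l))).
  by rewrite {1}/unpair /= 2!pedges_cons2.
rewrite EE -[map (@swap T) _]/[:: swap p, swap q & map (@swap T) ps] EE.
rewrite -[(swap p).1]/p.2 -[(swap p).2]/p.1 -[(swap q).1]/q.2.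
rewrite -[swap q :: _]/(map (@swap T) (q :: ps)) -[unpair (p :: _)]/[:: p.1, p.2 & unpair (q :: ps)].
rewrite 2!cons_uniq [p.1 \in _]inE negb_or => /andP [/andP [hp12 hp1] /andP [hp2 hu]].
have hq1 : q.1 \in unpair (q :: ps) by rewrite /unpair /= inE eqxx.
have hq2 : q.2 \in unpair (q :: ps) by rewrite /unpair /= !inE eqxx orbT.
have nin1 x f : f \in pedges (unpair (q :: ps)) -> x \notin unpair (q :: ps) -> x \notin f.
  by move=> hf; apply: contra; apply: pedges_sub.
have nin2 x f : f \in pedges (unpair (map (@swap T) (q :: ps))) ->
    x \notin unpair (q :: ps) -> x \notin f.
  by move=> hf; apply: contra => /(pedges_sub hf); rewrite Emem.
rewrite !in_setU1 => /or3P [/eqP ->|/eqP ->|he].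
- by move=> _; exists p; rewrite ?mem_head.
- case/or3P => [/eqP|/eqP|].
  + by move/setP/(_ q.1); rewrite !inE eqxx orbT => /esym /orP [] /eqP E;
      [move: hp2; rewrite -E hq1|move: hp1; rewrite -E hq1].
  + move/setP/(_ p.1); rewrite !inE eqxx (negPf hp12) /= => /eqP E.
    by move: hp1; rewrite E hq1.
  + by move/nin2/(_ hp2); rewrite !inE eqxx.
case/or3P => [/eqP E|/eqP E|he'].
- by move: (nin1 _ _ he hp1); rewrite E !inE eqxx orbT.
- by move: (nin1 _ _ he hp1); rewrite E !inE eqxx.
by have [r hr ->] := IH hu he he'; exists r; rewrite // inE hr orbT.
Qed.

Lemma set2_pair (T : finType) (e : {set T}) : #|e| == 2 ->
  exists p : T * T, p.1 != p.2 /\ e = [set p.1; p.2].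
Proof. by case/cards2P => x [y [h ->]]; exists (x, y). Qed.

Lemma matching_pairs (T : finType) (M : seq {set T}) :
  uniq M -> (forall e, e \in M -> #|e| == 2) ->
  (forall e f, e \in M -> f \in M -> ~~ [disjoint e & f] -> e = f) ->
  exists ps : seq (T * T), uniq (unpair ps) /\ M = [seq [set p.1; p.2] | p <- ps].
Proof.
elim: M => [|e M IH] /=; first by exists [::].
case/andP => heM hu h2 hd.
have [e' he'|e' f' he' hf'|ps [ups EM]] := IH hu.
- by apply: h2; rewrite inE he' orbT.
- by apply: hd; rewrite inE ?he' ?hf' orbT.
have [p [hp Ee]] := set2_pair (h2 e (mem_head _ _)).
exists (p :: ps); split; last by rewrite /= -EM -Ee.
have H x : x \in e -> x \notin unpair ps.
  move=> hx; apply/negP => /flattenP [l /mapP [r hr ->]] hxr.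
  have hrM : [set r.1; r.2] \in M by rewrite EM; apply/mapP; exists r.
  move: heM; rewrite (hd e [set r.1; r.2] (mem_head _ _)) ?hrM //.
    by rewrite inE hrM orbT.
  apply/pred0Pn; exists x; rewrite /= hx /=.
  by move: hxr; rewrite !inE.
rewrite /unpair /= inE negb_or -/(unpair ps) hp ups !H ?Ee ?inE ?eqxx ?orbT //.
Qed.

(** One of the two paths thus separates any edge of [M] from any given edge outside [M]. *)
Lemma matching_two_paths (T : finType) (M : {set {set T}}) :
  (forall e, e \in M -> #|e| == 2) ->
  (forall e f, e \in M -> f \in M -> ~~ [disjoint e & f] -> e = f) ->
  exists s t : seq T, [/\ uniq s, uniq t & M = pedges s :&: pedges t].
Proof.
move=> h2 hd.
have [||ps [ups EM]] := @matching_pairs T (enum M) (enum_uniq _).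
- by move=> e; rewrite mem_enum; apply: h2.
- by move=> e f; rewrite !mem_enum; apply: hd.
exists (unpair ps), (unpair (map (@swap T) ps)).
split; rewrite ?unpair_swap_uniq //; apply/setP => e; rewrite inE -mem_enum EM.
apply/mapP/andP => [[p hp ->]|[h1 h3]]; last exact: pedges_unpair_swap.
split; first exact: pedges_unpair.
by rewrite setUC; apply: (@pedges_unpair _ _ (swap p)); apply: map_f.
Qed.


(** Greedy colouring: when [x] is coloured, at most [D] colours occur on its neighbours and at most
    [#|H| %/ s] classes already have [s] elements, so one of the [C.+1] colours is free. *)
Lemma capped_coloring (T : finType) (r : rel T) (H : {set T}) (D s C : nat) :
  symmetric r -> 0 < s ->
  (forall x, x \in H -> #|[set y in H | r x y]| <= D) ->
  D + #|H| %/ s <= C ->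
  exists col : T -> 'I_C.+1,
    (forall x y, x \in H -> y \in H -> x != y -> r x y -> col x != col y) /\
    (forall c, #|[set x in H | col x == c]| <= s).
Proof.
move=> rS s0; elim: {H}_.+1 {-2}H (ltnSn #|H|) => // k IH H hk hD hC.
have [->|[x xH]] := set_0Vmem H.
  exists (fun=> ord0); split=> [x y|c]; first by rewrite inE.
  by rewrite (_ : [set _ in _ | _] = set0) ?cards0 //; apply/setP => z; rewrite !inE.
set H' := H :\ x.
have cH : #|H| = #|H'|.+1 by rewrite (cardsD1 x) xH.
have [|||col [col1 col2]] := IH H'.
- by rewrite -ltnS -cH.
- move=> y /setD1P [_ yH]; apply: leq_trans (hD y yH); apply/subset_leq_card/subsetP => z.
  by rewrite !inE => /andP [/andP [_ ->] ->].
- by apply: leq_trans hC; rewrite leq_add2l leq_div2r // cH.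
pose near := [set col y | y in [set y in H | r x y]].
pose full := [set c | s <= #|[set y in H' | col y == c]|].
have hn : #|near| <= D by apply: leq_trans (leq_imset_card _ _) (hD x xH).
have hf : #|full| <= #|H| %/ s.
  rewrite leq_divRL // cH; apply: leqW; rewrite -sum_nat_const.
  apply: leq_trans (_ : \sum_(c in full) #|[set y in H' | col y == c]| <= _).
    by apply: leq_sum => c; rewrite inE.
  rewrite -[X in _ <= X]sum1_card (partition_big col predT) //=.
  rewrite [X in _ <= X](bigID (mem full)) /= -[X in X <= _]addn0 leq_add //.
  by apply: leq_sum => c _; rewrite -sum1_card; under eq_bigl => y do rewrite inE.
have [c0 hc0] : exists c, c \notin near :|: full.
  apply/existsP; rewrite -negb_forall; apply/negP => /forallP h.
  have : #|[set: 'I_C.+1]| <= #|near :|: full|.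
    by apply/subset_leq_card/subsetP => z _; apply: h.
  rewrite cardsT card_ord leqNgt ltnS => /negP []; apply: leq_trans hC.
  by apply: leq_trans (leq_card_setU _ _) _; apply: leq_add.
move: hc0; rewrite !inE negb_or => /andP [hn0 hf0].
exists (fun y => if y == x then c0 else col y); split.
  move=> a b aH bH ab rab; have [ax|ax] := eqVneq a x; have [bx|bx] := eqVneq b x.
  - by rewrite ax bx eqxx in ab.
  - by apply: contraNneq hn0 => ->; apply/imsetP; exists b; rewrite // inE bH -ax.
  - by apply: contraNneq hn0 => <-; apply/imsetP; exists a; rewrite // inE aH rS -bx.
  - by apply: col1; rewrite // !inE ?ax ?bx.
move=> c; have [->|cc] := eqVneq c c0.
  apply: leq_trans (_ : #|x |: [set y in H' | col y == c0]| <= _).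
    apply/subset_leq_card/subsetP => y; rewrite !inE.
    by case: (eqVneq y x) => //= _ /andP [-> ->].
  rewrite cardsU1 !inE eqxx /= add1n; rewrite ltnNge //.
apply: leq_trans (col2 c); apply/subset_leq_card/subsetP => y; rewrite !inE.
by case: (eqVneq y x) => [_|_ /andP [-> ->]] //; rewrite [c0 == c]eq_sym (negPf cc) andbF.
Qed.

(* Two colourings of [H] into matchings such that a colour class of the first
   and one of the second share at most one edge. *)
Lemma separate_sparse (V : finType) (H : {set {set V}}) (D s C1 C2 : nat) :
  (forall e, e \in H -> #|e| == 2) ->
  (forall v, #|[set e in H | v \in e]| <= D) -> 0 < s ->
  2 * D + #|H| %/ s <= C1 -> 2 * D + s <= C2 ->
  exists F : seq (seq V), [/\ {in F, forall t, uniq t},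
    size F = 2 * (C1.+1 + C2.+1) & forall e, e \in H -> separates F e].
Proof.
move=> h2 hD s0 hC1 hC2.
pose meet (e f : {set V}) := ~~ [disjoint e & f].
have mS : symmetric meet by move=> e f; rewrite /meet disjoint_sym.
have hm e : e \in H -> #|[set f in H | meet e f]| <= 2 * D.
  move=> eH; have [p [_ Ee]] := set2_pair (h2 e eH).
  rewrite mul2n -addnn; apply: leq_trans (leq_add (hD p.1) (hD p.2)).
  apply: leq_trans (leq_card_setU _ _); apply/subset_leq_card/subsetP => f.
  rewrite !inE => /andP [-> /=]; rewrite /meet Ee => /pred0Pn [x /=].
  by rewrite !inE => /andP [/orP [] /eqP ->] ->; rewrite ?orbT.
have [c1 [c1P c1s]] := capped_coloring mS s0 hm hC1.
(* The second colouring also distinguishes edges with the same first colour; each such class has at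
   most [s] elements, which explains the degree bound [2 * D + s]. *)
pose r2 e f := meet e f || (c1 e == c1 f).
have r2S : symmetric r2 by move=> e f; rewrite /r2 mS eq_sym.
(* A cap larger than [#|H|] makes the quotient in the colour bound vanish. *)
have [|||c2 [c2P _]] := @capped_coloring _ r2 H (2 * D + s) #|H|.+1 C2 r2S.
- by [].
- move=> e eH; apply: leq_trans (leq_add (hm e eH) (c1s (c1 e))).
  apply: leq_trans (leq_card_setU _ _); apply/subset_leq_card/subsetP => f.
  by rewrite !inE /r2 andb_orr [c1 f == _]eq_sym.
- by rewrite divn_small // addn0.
(* Two paths per colour class separate [e] from everything except the edges of its own class. *)
have paths (C : nat) (col : {set V} -> 'I_C) :
    (forall x y, x \in H -> y \in H -> x != y -> meet x y -> col x != col y) ->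
    exists F : seq (seq V), [/\ {in F, forall t, uniq t}, size F = 2 * C &
    forall e f, e \in H -> (exists2 s, s \in F & (e \in pedges s) && (f \notin pedges s)) \/
      (f \in H) && (col f == col e)].
  move=> hcol; pose M c := [set e in H | col e == c].
  have hM c : {st : seq V * seq V | [&& uniq st.1, uniq st.2 & M c == pedges st.1 :&: pedges st.2]}.
    apply: sig_eqW.
    have [||s' [t [h3 h4 h5]]] := @matching_two_paths _ (M c).
    - by move=> e; rewrite inE => /andP [/h2].
    - move=> e f; rewrite !inE => /andP [eH /eqP ce] /andP [fH /eqP cf] ef.
      by apply/eqP; apply/negPn/negP => /(hcol e f eH fH) /(_ ef); rewrite ce cf eqxx.
    by exists (s', t); rewrite h3 h4 h5 eqxx.
  exists ([seq (sval (hM c)).1 | c <- enum 'I_C] ++ [seq (sval (hM c)).2 | c <- enum 'I_C]).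
  split.
  - by move=> t; rewrite mem_cat => /orP [] /mapP [c _ ->]; case: (hM c) => st /= /and3P [].
  - by rewrite size_cat 2!size_map !size_enum_ord mul2n addnn.
  move=> e f eH; have [fM|] := boolP (f \in M (col e)).
    by right; move: fM; rewrite inE.
  have : e \in M (col e) by rewrite inE eH eqxx.
  case E: (hM (col e)) => [[s1 t1] /= P].
  have /and3P [_ _ /eqP ->] := P.
  rewrite !inE negb_and => /andP [es et] /orP [fs|ft]; left.
  - exists s1; last by rewrite es.
    by rewrite mem_cat; apply/orP; left; apply/mapP; exists (col e); rewrite ?mem_enum // E.
  - exists t1; last by rewrite et.
    by rewrite mem_cat; apply/orP; right; apply/mapP; exists (col e); rewrite ?mem_enum // E.
have [F1 [u1 z1 P1]] := paths _ c1 c1P.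
have [|F2 [u2 z2 P2]] := paths _ c2.
  by move=> e f eH fH ef m; apply: c2P; rewrite // /r2 m.
exists (F1 ++ F2); split.
- by move=> t; rewrite mem_cat => /orP [/u1|/u2].
- by rewrite size_cat z1 z2 mulnDr.
move=> e eH f fe; have [[t tF tP]|/andP [fH /eqP cf]] := P1 e f eH.
  by exists t; rewrite // mem_cat tF.
have [[t tF tP]|/andP [_ cf2]] := P2 e f eH.
  by exists t; rewrite // mem_cat tF orbT.
have : c2 f != c2 e by apply: c2P; rewrite // /r2 cf eqxx orbT.
by rewrite cf2.
Qed.

(** * Transfer and lower bound *)

Lemma zip_behead_map (S T : Type) (g : S -> T) (s : seq S) :
  zip (map g s) (behead (map g s)) = [seq (g p.1, g p.2) | p <- zip s (behead s)].
Proof. by elim: s => [|a [|b s] IH] //=; rewrite -IH. Qed.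

Lemma pedges_map (S T : finType) (g : S -> T) (s : seq S) :
  pedges (map g s) = [set g @: e | e : {set S} in pedges s].
Proof.
apply/setP => e; apply/pedgesP/imsetP => [[x [y []]]|[e' /pedgesP [x [y [h ->]]] ->]].
  rewrite zip_behead_map => /mapP [[a b] h [-> ->]] ->.
  by exists [set a; b]; [apply/pedgesP; exists a, b|rewrite imsetU1 imset_set1].
exists (g x), (g y); rewrite imsetU1 imset_set1; split=> //.
by rewrite zip_behead_map; apply/mapP; exists (x, y).
Qed.

(** Every duplicate-free list is a path of the complete graph, so the construction may use any
    vertex type with [n] elements. *)
Lemma ssp_K_le (n : nat) (V : finType) (F : seq (seq V)) :
  #|V| = n -> {in F, forall s, uniq s} ->
  (forall x y, x != y -> separates F [set x; y]) -> ssp_K n <= size F.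
Proof.
move=> cV uF sF; rewrite /ssp_K; case: ex_minnP => k _; apply.
pose g (x : V) : 'I_n := cast_ord cV (enum_rank x).
have gi : injective g by move=> x y /cast_ord_inj /enum_rank_inj.
have gs (z : 'I_n) : exists x, z = g x.
  by exists (enum_val (cast_ord (esym cV) z)); rewrite /g enum_valK cast_ordKV.
have gg := imset_inj gi.
have mg s (e : {set V}) : (g @: e \in pedges (map g s)) = (e \in pedges s) by rewrite pedges_map mem_imset.
apply/classbP; exists (map (map g) F); split; first by rewrite size_map.
split=> [_ /mapP [s /uF us ->]|e f].
  rewrite /gpath map_inj_uniq // us; case: s us => //= x s us.
  elim: s x us => //= y s IH x /andP []; rewrite inE negb_or => /andP [xy _] us.
  by rewrite IH // /Kn (inj_eq gi) xy.
have ge e' : e' \in gedges (Kn n) -> exists x y, x != y /\ e' = g @: [set x; y].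
  case/imset2P => x y _; rewrite !inE /= andbb.
  have [[a ->] [b ->]] := (gs x, gs y); rewrite /Kn (inj_eq gi) => ab ->.
  by exists a, b; rewrite imsetU1 imset_set1.
move=> /ge [x [y [xy ->]]] /ge [a [b [ab ->]]]; rewrite (inj_eq gg) eq_sym => fe.
have [s sin hs] := sF x y xy _ fe.
by exists (map g s); rewrite ?map_f // !mg.
Qed.

Lemma mem_gedges_Kn (n : nat) (x y : 'I_n) : x != y -> [set x; y] \in gedges (Kn n).
Proof. by move=> xy; apply/imset2P; exists x y; rewrite // !inE /Kn xy. Qed.

Lemma card_gedges_Kn (n : nat) : #|gedges (Kn n)| = 'C(n, 2).
Proof.
rewrite -[n in RHS]card_ord -card_draws; apply: eq_card => e; rewrite inE.
apply/imset2P/cards2P => [[x y _]|[x [y [xy ->]]]].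
  by rewrite !inE /= andbb => xy ->; exists x, y.
by exists x y; rewrite // !inE /Kn xy.
Qed.

Lemma ssp_K_ge (n : nat) : 2 < n -> n <= ssp_K n.
Proof.
move=> n3; rewrite /ssp_K; case: ex_minnP => k /classbP [F [<- [pF sF]]] _.
have uF s : s \in F -> uniq s by move=> /pF /andP [].
have pE s e : s \in F -> e \in pedges s -> e \in gedges (Kn n).
  move=> /uF us /pedgesP [x [y [h ->]]].
  by apply: mem_gedges_Kn; apply: zip_behead_neq h.
(* A path consisting of the single edge [e] counts twice; its total weight 2 is still at most
   [n.-1], as [n] is at least 3. *)
pose w (s : seq 'I_n) e := (e \in pedges s) * (1 + (pedges s == [set e])).
have upper s : s \in F -> \sum_(e in gedges (Kn n)) w s e <= n.-1.
  move=> sin; rewrite (bigID (mem (pedges s))) /=.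
  rewrite [X in _ + X]big1 ?addn0 => [|e /andP [_ /negPf h]]; last by rewrite /w h.
  rewrite (eq_bigl (mem (pedges s))) => [|e]; last first.
    by apply/andP/idP => [[]|h]//; split=> //; apply: pE h.
  have [/cards1P [e Es]|h1] := boolP (#|pedges s| == 1).
    rewrite Es big_set1 /w Es !inE !eqxx.
    by rewrite -ltnS prednK // (ltn_trans _ n3).
  rewrite (eq_bigr (fun=> 1)) => [|e es]; last first.
    rewrite /w (es : e \in pedges s); case: eqP => // E; by rewrite E cards1 in h1.
  rewrite sum1_card; apply: leq_trans (card_pedges s) _.
  rewrite -!subn1 leq_sub2r //; apply: leq_trans (_ : #|'I_n| <= _); last by rewrite card_ord.
  by rewrite cardE; apply: uniq_leq_size (uF s sin) _ => x; rewrite mem_enum.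
(* Separating [e] from some other edge gives a path through [e]. If that path has a further edge
   [f], separating [e] from [f] requires a second path through [e]. *)
have lower e : e \in gedges (Kn n) -> 2 <= \sum_(s <- F) w s e.
  move=> eE; have [x xe] : exists f, f \in gedges (Kn n) :\ e.
    apply/set0Pn; rewrite -card_gt0; have := card_gedges_Kn n.
    by rewrite (cardsD1 e) eE add1n => E; rewrite -ltnS E (leq_trans _ (leq_bin2l 2 n3)).
  move: xe => /setD1P [xe xE]; have [|s sin /andP [es xs]] := sF e x eE xE; first by rewrite eq_sym.
  have [h1|] := boolP (pedges s == [set e]).
    rewrite (big_rem s sin) /= {1}/w es h1; exact: leq_addr.
  rewrite eqEsubset sub1set es andbT => /subsetPn [f fs]; rewrite inE => fe.
  have [|t tin /andP [et ft]] := sF e f eE (pE _ _ sin fs); first by rewrite eq_sym.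
  have ts : t \in rem s F.
    move: tin; rewrite (perm_mem (perm_to_rem sin)) inE => /orP [/eqP E|//].
    by rewrite E fs in ft.
  rewrite (big_rem s sin) /= (big_rem t ts) /= {1 2}/w es et !mul1n addnA.
  by apply: leq_trans (leq_addr _ _); rewrite addnACA leq_addr.
have : 'C(n, 2) * 2 <= size F * n.-1.
  rewrite -card_gedges_Kn -sum_nat_const.
  apply: leq_trans (_ : \sum_(e in gedges (Kn n)) \sum_(s <- F) w s e <= _).
    exact: leq_sum.
  rewrite exchange_big /= -sum1_size big_distrl /= big_seq [X in _ <= X]big_seq.
  by apply: leq_sum => s; rewrite mul1n; apply: upper.
have -> : 'C(n, 2) * 2 = n * n.-1.
  by rewrite mulnC -(mul_bin_diag n 1) bin1.
by rewrite leq_pmul2r // -ltnS prednK (ltn_trans _ n3).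
Qed.

Local Open Scope ring_scope.

(** * The base path *)

Definition steps (T : Type) (s : seq T) : seq (T * T) := zip s (behead s).

Lemma steps_cat (T : Type) (x y : T) (s t : seq T) :
  steps ((x :: s) ++ y :: t) = steps (x :: s) ++ (last x s, y) :: steps (y :: t).
Proof. by elim: s x => [|z s IH] x //=; rewrite -IH. Qed.

Lemma steps_succ (T : eqType) (x a : T) (s : seq T) :
  a \in x :: s -> a != last x s -> exists b, (a, b) \in steps (x :: s).
Proof.
elim: s x => [|y s IH] x /=; first by rewrite inE => /eqP ->; rewrite eqxx.
rewrite inE => /orP [/eqP -> _|/IH h /h [b hb]].
  by exists y; rewrite /steps /= inE eqxx.
by exists b; rewrite /steps /= inE [_ \in _]hb orbT.
Qed.

Lemma fpath_steps (T : eqType) (f : T -> T) (x a b : T) (s : seq T) :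
  fpath f x s -> (a, b) \in steps (x :: s) -> b = f a.
Proof.
elim: s x => [|y s IH] x //= /andP [/eqP <- hp].
by rewrite /steps /= inE => /orP [/eqP [-> ->]|/(IH _ hp)].
Qed.

Lemma set2_inj (T : finType) (x y x' y' : T) : [set x; y] = [set x'; y'] ->
  (x = x' /\ y = y') \/ (x = y' /\ y = x').
Proof.
move=> E; have := (set21 x y, set22 x y, set21 x' y', set22 x' y').
rewrite {1 2}E -{3 4}E !inE => -[[[]]].
by do 4! case/orP => /eqP ?; subst; auto.
Qed.

Section BasePath.
Variable R : finComNzRingType.
Implicit Types (x y a b u v D : R) (p : seq R) (ks : seq (R * R)).

Definition dbl x : R := x + x.
Hypothesis dbl_inj : injective dbl.

(** The invariant of the greedy concatenation. Closure under doubling makes [p] a union of whole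
    orbits. Distinct link differences keep two translates from sharing a link, and the condition on
    [DD] keeps shifts by its elements from moving a link onto a doubling edge. Each link is paid for
    by [L] vertices, so links are few. *)
Definition linked (DD : {set R}) (L : nat) p ks : Prop :=
  [/\ uniq p, {homo dbl : x / x \in p},
      forall a b, (a, b) \in steps p -> b = dbl a \/ (a, b) \in ks
    & [/\ {in ks &, forall k l, k.2 - k.1 = l.2 - l.1 \/ k.2 - k.1 = - (l.2 - l.1) -> k = l},
      {in ks & DD, forall k D, k.2 != dbl k.1 + D /\ k.1 != dbl k.2 + D}
    & (L * size ks <= size p)%N]].

Lemma orbit_cons x : exists s, orbit dbl x = x :: s /\ fpath dbl x s.
Proof.
rewrite /orbit; have := order_gt0 dbl x; case: (order dbl x) => // k _.
by exists (traject dbl (dbl x) k); split=> //; apply: fpath_traject.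
Qed.

Lemma orbit_dbl_closed x : {homo dbl : y / y \in orbit dbl x}.
Proof. by move=> y; rewrite -!fconnect_orbit => h; apply: connect_trans h (fconnect1 _ _). Qed.

(** Doubling permutes the finite ring, so iterating it from [y] leads back to [x]; a closed list
    containing [y] would contain [x]. *)
Lemma dbl_closed_orbit p x y : {homo dbl : z / z \in p} -> x \notin p ->
  y \in orbit dbl x -> y \notin p.
Proof.
move=> hp xp; rewrite -fconnect_orbit fconnect_sym // => /iter_findex E.
apply: contra xp => yp; rewrite -E.
by elim: findex => [|k IH] //=; apply: hp.
Qed.

Lemma linked_orbit DD L x : linked DD L (orbit dbl x) [::].
Proof.
split; [exact: orbit_uniq|exact: orbit_dbl_closed| |by split; rewrite ?muln0].
by have [s [-> hs]] := orbit_cons x; move=> a b /(fpath_steps hs); left.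
Qed.

Lemma linked_extend DD L u s ks v (u' := last u s) :
  linked DD L (u :: s) ks -> v \notin u :: s -> (L <= order dbl v)%N ->
  {in ks, forall k, v - u' != k.2 - k.1 /\ v - u' != - (k.2 - k.1)} ->
  {in DD, forall D, v != dbl u' + D /\ u' != dbl v + D} ->
  linked DD L ((u :: s) ++ orbit dbl v) ((u', v) :: ks).
Proof.
case=> hu hc hs [hk hD hL] vp Lv hvk hvD.
have [t [Et ht]] := orbit_cons v.
split; last split.
- rewrite cat_uniq hu orbit_uniq andbT /=; apply/hasPn => y.
  exact: dbl_closed_orbit hc vp.
- by move=> x; rewrite !mem_cat => /orP [/hc ->|/orbit_dbl_closed ->]; rewrite ?orbT.
- move=> a b; rewrite Et steps_cat mem_cat in_cons.
  case/or3P => [/hs [->|h]|/eqP [-> ->]|/(fpath_steps ht) ->].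
  + by left.
  + by right; rewrite inE h orbT.
  + by right; rewrite inE eqxx.
  + by left.
- move=> k l; rewrite !inE => /orP [/eqP ->|kk] /orP [/eqP ->|ll] //=.
  + by case: (hvk l ll) => /eqP h1 /eqP h2 [/h1|/h2].
  + case: (hvk k kk) => /eqP h1 /eqP h2 [/esym/h1|E] //.
    by case: h2; rewrite E opprK.
  + exact: hk.
- by move=> k D; rewrite inE => /orP [/eqP -> /hvD|/hD]//; apply.
- rewrite -[size (_ :: ks)]/(size ks).+1 mulnS addnC size_cat leq_add //.
  by rewrite /orbit size_traject.
Qed.

(** Orbits are appended until the remaining vertices may all be forbidden as the next start: two for
    each link, two for each element of [DD], and those on short orbits. The set [S] lies in the
    first orbit and avoids its last vertex, so no link touches it. *)
Lemma greedy_linked DD L (S : {set R}) x0 :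
  {subset S <= orbit dbl x0} -> last x0 (orbit dbl x0) \notin S ->
  exists p ks,
  [/\ linked DD L p ks, {subset steps (orbit dbl x0) <= steps p},
      {in ks, forall k, (k.1 \notin S) && (k.2 \notin S)}, (0 < size p)%N
    & (#|[set x | x \notin p]| <=
       2 * size ks + 2 * #|DD| + #|[set x | order dbl x < L]|)%N].
Proof.
move=> Sx lS.
suff H k p ks : (#|[set x | x \notin p]| < k)%N -> (0 < size p)%N ->
    linked DD L p ks -> {subset S <= p} -> last x0 p \notin S ->
    {subset steps (orbit dbl x0) <= steps p} ->
    {in ks, forall k, (k.1 \notin S) && (k.2 \notin S)} ->
  exists p ks,
  [/\ linked DD L p ks, {subset steps (orbit dbl x0) <= steps p},
      {in ks, forall k, (k.1 \notin S) && (k.2 \notin S)}, (0 < size p)%N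
    & (#|[set x | x \notin p]| <=
       2 * size ks + 2 * #|DD| + #|[set x | order dbl x < L]|)%N].
  apply: (H _ (orbit dbl x0) [::] (ltnSn _)) => //.
    by rewrite /orbit size_traject order_gt0.
  exact: linked_orbit.
elim: k p ks => // k IH p ks hk p0 hl Sp lp sp ksS.
have [le|gt] := leqP #|[set x | x \notin p]| (2 * size ks + 2 * #|DD| + #|[set x | order dbl x < L]|)%N.
  by exists p, ks.
case: p hk p0 hl Sp lp sp gt => // u s hk _ hl Sp lp sp gt.
set u' := last u s.
(* The first two sets would repeat a link difference up to sign, the next two would violate the
   condition on [DD], and [bad5] collects the short orbits. *)
pose bad1 := [set x in [seq u' + (k.2 - k.1) | k <- ks]].
pose bad2 := [set x in [seq u' - (k.2 - k.1) | k <- ks]].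
pose bad3 := [set dbl u' + D | D in DD].
pose bad4 := [set v | dbl v \in [set u' - D | D in DD]].
pose bad5 := [set x | (order dbl x < L)%N].
have [v] : exists v, v \in [set x | x \notin u :: s] :\: (bad1 :|: bad2 :|: (bad3 :|: bad4) :|: bad5).
  apply/set0Pn; apply: contraTneq gt => /eqP; rewrite setD_eq0 -leqNgt => /subset_leq_card h.
  apply: leq_trans h _; do 2![apply: leq_trans (leq_card_setU _ _) _; apply: leq_add => //].
    rewrite mul2n -addnn; apply: leq_trans (leq_card_setU _ _) _; apply: leq_add => //.
      by rewrite cardsE (leq_trans (card_size _)) ?size_map.
    by rewrite cardsE (leq_trans (card_size _)) ?size_map.
  rewrite mul2n -addnn; apply: leq_trans (leq_card_setU _ _) _; apply: leq_add.
    exact: leq_imset_card.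
  rewrite -(card_imset _ dbl_inj); apply: leq_trans (leq_imset_card (fun D => u' - D) DD).
  by apply/subset_leq_card/subsetP => _ /imsetP [v + ->]; rewrite inE.
rewrite !inE !negb_or -!andbA => /and5P [nb1 nb2 nb3 nb4 /and3P [nb5 vu vs]].
have vp : v \notin u :: s by rewrite inE negb_or vu vs.
rewrite -leqNgt in nb5.
have hl' : linked DD L ((u :: s) ++ orbit dbl v) ((u', v) :: ks).
  apply: linked_extend => // [l lk|D hD].
    split; [apply: contraNneq nb1 => E|apply: contraNneq nb2 => E]; apply/mapP; exists l => //.
      by rewrite -E addrC subrK.
    by rewrite -E addrC subrK.
  split; [apply: contraNneq nb3 => ->|apply: contraNneq nb4 => E]; apply/imsetP; exists D => //.
  by apply/eqP; rewrite eq_sym subr_eq; apply/eqP.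
have hcl : {homo dbl : x / x \in u :: s} by case: hl.
have [t [Et _]] := orbit_cons v.
apply: (IH _ _ _ _ hl') => //.
- rewrite -ltnS; apply: leq_trans hk; rewrite ltnS; apply: proper_card; apply/properP.
  split; first by apply/subsetP => x; rewrite !in_set mem_cat negb_or => /andP [].
  by exists v; rewrite in_set // negbK mem_cat Et mem_head orbT.
- by move=> x /Sp h; rewrite mem_cat h.
- apply: contra vp => /Sp; rewrite last_cat Et /= => h.
  apply: contraLR h => vp; apply: (dbl_closed_orbit hcl vp).
  by rewrite Et mem_last.
- move=> e /sp he; rewrite Et steps_cat mem_cat; by rewrite he.
- move=> l; rewrite inE => /orP [/eqP ->|/ksS //] /=.
  by rewrite lp; apply: contra vp => /Sp.
Qed.

(** A vertex that is not followed by its double is off the path, the start of a link, or the last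
    vertex. *)
Lemma card_not_doubled DD L p ks : linked DD L p ks -> (0 < size p)%N ->
  (#|[set a | (a, dbl a) \notin steps p]| <= #|[set x | x \notin p]| + size ks + 1)%N.
Proof.
case=> _ _ hs _; case: p hs => // u s hs _.
rewrite -(cards1 (last u s)) -(size_map fst ks).
apply: leq_trans (_ : #|[set x | x \notin u :: s] :|: [set x in map fst ks] :|: [set last u s]| <= _)%N.
  apply/subset_leq_card/subsetP => a; rewrite !in_setU !in_set => ha.
  have [->|al] := eqVneq a (last u s); first by rewrite ?in_set1 ?eqxx orbT.
  have [ap|//] := boolP (a \in u :: s).
  have [b hb] := steps_succ ap al; case: (hs _ _ hb) => [E|hk].
    by rewrite E in hb; rewrite hb in ha.
  by apply/orP; left; apply/orP; right; apply/mapP; exists (a, b).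
apply: leq_trans (leq_card_setU _ _) _; rewrite leq_add //.
apply: leq_trans (leq_card_setU _ _) _; rewrite leq_add //.
by rewrite cardsE card_size.
Qed.

End BasePath.

(** * Translates of the base path *)

Lemma separates_two (T : finType) (F : seq (seq T)) (e : {set T}) (s t : seq T) :
  s \in F -> t \in F -> e \in pedges s -> e \in pedges t ->
  (forall f, f \in pedges s -> f \in pedges t -> f = e) -> separates F e.
Proof.
move=> sF tF es et h f fe; have [fs|fs] := boolP (f \in pedges s).
  exists t; rewrite // et; apply: contra fe => ft; exact/eqP/h.
by exists s; rewrite ?es.
Qed.

Section Translates.
Variables (R : finComNzRingType) (c : nat).
Implicit Types (x y a b u v D : R) (p : seq R) (ks : seq (R * R)).
Notation dbl := (@dbl R).
Hypothesis dbl_inj : injective dbl.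
Definition trpl x : R := x + x + x.
Hypothesis trpl_inj : injective trpl.

(** The orbit of 1 begins 1, 2, 4, 8, and so on. Removing only the vertices [2 * 4 ^ j] leaves both
    neighbours [4 ^ j] and [4 ^ j.+1] of each in place. *)
Definition pow4 (j : nat) : R := 4%:R ^+ j.
Hypothesis pow4_inj : forall i j, (i <= c)%N -> (j <= c)%N -> pow4 i = pow4 j -> i = j.
Hypothesis pow4_neg : forall i j, (i <= c)%N -> (j <= c)%N -> pow4 i <> - pow4 j.
Hypothesis pow4_dbl : forall i j, (i < c)%N -> (j <= c)%N -> dbl (pow4 i) <> pow4 j.

Definition removed : {set R} := [set dbl (pow4 i) | i : 'I_c].
(* The shifts between the two translates of the path that contain a given edge
   at the [j]-th fixed point. *)
Definition reserved : {set R} :=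
  [set trpl (pow4 i) | i : 'I_c] :|: [set - trpl (pow4 i) | i : 'I_c].

(* The vertex [2 * 4 ^ j] of the base path is replaced by the [j]-th point
   outside [R], which the translations fix. *)
Definition place x : R + 'I_c :=
  if [pick j : 'I_c | x == dbl (pow4 j)] is Some j then inr j else inl x.

Definition shift (i : R) (v : R + 'I_c) : R + 'I_c :=
  match v with inl x => inl (x + i) | inr j => inr j end.

Lemma dbl_pow4 j : dbl (dbl (pow4 j)) = pow4 j.+1.
Proof. by rewrite /dbl /pow4 exprS; ring. Qed.

Lemma removedP x : reflect (exists j : 'I_c, x = dbl (pow4 j)) (x \in removed).
Proof. by apply: (iffP imsetP) => [[j _ ->]|[j ->]]; exists j. Qed.

Lemma place_inl x : x \notin removed -> place x = inl x.
Proof.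
rewrite /place; case: pickP => // j /eqP -> /negP [].
by apply/removedP; exists j.
Qed.

Lemma place_inr (j : 'I_c) : place (dbl (pow4 j)) = inr j.
Proof.
rewrite /place; case: pickP => [k /eqP /dbl_inj /pow4_inj E|/(_ j)]; last by rewrite eqxx.
by congr inr; apply/esym/val_inj/E; apply: ltnW.
Qed.

Lemma place_inj : injective place.
Proof.
move=> x y; have [/removedP [j ->]|hx] := boolP (x \in removed);
have [/removedP [k ->]|hy] := boolP (y \in removed);
  rewrite ?place_inr ?(place_inl hx) ?(place_inl hy) //; by case=> ->.
Qed.

Lemma shift_inj i : injective (shift i).
Proof. by move=> [x|j] [y|k] //= [] E; rewrite ?E // (addIr _ E). Qed.

Lemma pow4_not_removed j : (j <= c)%N -> pow4 j \notin removed.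
Proof. by move=> jc; apply/removedP => -[i /esym /pow4_dbl]; apply. Qed.

Definition translate p i := map (fun x => shift i (place x)) p.

Variables (L : nat) (p : seq R) (ks : seq (R * R)).
Hypothesis pL : linked reserved L p ks.
Hypothesis ks_removed : {in ks, forall k, (k.1 \notin removed) && (k.2 \notin removed)}.
Hypothesis steps_pow4 : forall j, (j < c)%N ->
  (pow4 j, dbl (pow4 j)) \in steps p /\ (dbl (pow4 j), pow4 j.+1) \in steps p.

Definition edge_kind (i : R) (e : {set (R + 'I_c)%type}) : Prop :=
  [\/ exists2 a, (a \notin removed) && (dbl a \notin removed) & e = [set inl (a + i); inl (dbl a + i)],
      exists2 k, k \in ks & e = [set inl (k.1 + i); inl (k.2 + i)]
    | exists j : 'I_c, e = [set inl (pow4 j + i); inr j] \/ e = [set inl (pow4 j.+1 + i); inr j]].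

Lemma mem_translate i a b : (a, b) \in steps p ->
  [set shift i (place a); shift i (place b)] \in pedges (translate p i).
Proof.
move=> h; apply/pedgesP; exists (shift i (place a)), (shift i (place b)); split=> //.
by rewrite /translate zip_behead_map; apply/mapP; exists (a, b).
Qed.

(** Links avoid the removed vertices, so an edge at a fixed point comes from a doubling step into or
    out of some [2 * 4 ^ j]. *)
Lemma translate_edge_kind i e : e \in pedges (translate p i) -> edge_kind i e.
Proof.
case: pL => _ _ hs _.
case/pedgesP => x [y []]; rewrite /translate zip_behead_map => /mapP [[a b] ab [-> ->]] -> /=.
case: (hs _ _ ab) => [Eb|abk]; last first.
  apply: Or32; exists (a, b) => //.
  by have /andP [ha hb] := ks_removed abk; rewrite !place_inl.
have [/removedP [j Ea]|ha] := boolP (a \in removed).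
  apply: Or33; exists j; right; rewrite Eb Ea dbl_pow4 place_inr place_inl ?pow4_not_removed //=.
  by rewrite setUC.
have [/removedP [j Ej]|hb] := boolP (b \in removed).
  apply: Or33; exists j; left; rewrite Ej place_inr place_inl //=.
  by rewrite (dbl_inj (etrans (esym Eb) Ej)).
by apply: Or31; exists a; rewrite ?ha -?Eb // !place_inl.
Qed.

(** This says that a shift by [D] or [- D] moves some link onto an edge [{x, 2x}], in one of the two
    orientations. *)
Definition conflict D : Prop :=
  exists2 k, k \in ks & [\/ k.2 = dbl k.1 + D, k.2 = dbl k.1 - D, k.1 = dbl k.2 + D | k.1 = dbl k.2 - D].

(** The kinds of the edge in the two translates are compared. Doubling edges of distinct translates
    agree only with ends exchanged, which forces a shift by [3a]; two links never agree; a link and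
    a doubling edge give a conflict; at a fixed point the two neighbours differ by [3 * 4 ^ j]. *)
Lemma common_edge i i' e : i != i' -> edge_kind i e -> edge_kind i' e ->
  [\/ exists2 j : 'I_c, i' - i = trpl (pow4 j) & e = [set inl (pow4 j.+1 + i); inr j],
      exists2 j : 'I_c, i' - i = - trpl (pow4 j) & e = [set inl (pow4 j + i); inr j],
      exists a, [/\ i' - i = trpl a, dbl (- a) \notin removed & e = [set inl (a + i); inl (dbl a + i)]]
    | conflict (i' - i)].
Proof.
have [d ->] : exists d, i' = i + d by exists (i' - i); rewrite addrC subrK.
have -> : i + d - i = d by ring.
move=> di; have {di} d0 : d <> 0 by move=> E; rewrite E addr0 eqxx in di.
have key x y : x + i = y + (i + d) -> x = y + d.
  by rewrite [i + d]addrC addrA => /addIr.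
have inlI x y : inl x = inl y :> R + 'I_c -> x = y by case.
have same u : u = u + d -> False.
  by move=> /eqP; rewrite -subr_eq0 opprD addrA subrr sub0r oppr_eq0 => /eqP.
(* A link mapped to itself with its ends exchanged would give [2d = 0]. *)
have swap2 u v : u = v + d -> v = u + d -> False.
  move=> -> /eqP; rewrite -subr_eq0 => /eqP E; apply: d0; apply: dbl_inj.
  by rewrite /dbl addr0 -[RHS](oppr0 R) -E; ring.
case=> [[a /andP [ha hda] ->]|[k kk ->]|[j Ej]].
- case=> [[b /andP [hb hdb]]|[l ll]|[l [|]]] /set2_inj.
  + case=> -[/inlI /key E1 /inlI /key E2].
      by case: (same (dbl b + d)); rewrite -[LHS]E2 E1 /dbl; ring.
    have Eb : b = - a.
      apply/eqP; rewrite -subr_eq0 opprK.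
      have -> : b + a = (dbl a - (b + d)) - (a - (dbl b + d)) by rewrite /dbl; ring.
      by rewrite E2 -E1 !subrr.
    apply: Or43; exists a; rewrite -Eb; split=> //.
    by apply: (addrI (dbl b)); rewrite -E1 Eb /dbl /trpl; ring.
  + case=> -[/inlI /key E1 /inlI /key E2]; apply: Or44; exists l => //.
      by apply: Or41; apply: (addIr d); rewrite -E2 E1 /dbl; ring.
    by apply: Or43; apply: (addIr d); rewrite -E2 E1 /dbl; ring.
  + by case=> -[].
  + by case=> -[].
- case=> [[b /andP [hb hdb]]|[l ll]|[l [|]]] /set2_inj.
  + case=> -[/inlI /key E1 /inlI /key E2]; apply: Or44; exists k => //.
      by apply: Or42; rewrite E2 E1 /dbl; ring.
    by apply: Or44; rewrite E2 E1 /dbl; ring.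
  + case: pL => _ _ _ [hk _ _].
    case=> -[/inlI /key E1 /inlI /key E2]; exfalso.
      have kl : k = l by apply: hk => //; left; rewrite E1 E2; ring.
      by apply: (same l.1); rewrite -E1 kl.
    have kl : k = l by apply: hk => //; right; rewrite E1 E2; ring.
    by apply: (swap2 k.1 k.2); rewrite {2}kl.
  + by case=> -[].
  + by case=> -[].
- case=> [[b /andP [hb hdb]]|[l ll]|[l El]].
  + by case: Ej => -> /set2_inj; case=> -[].
  + by case: Ej => -> /set2_inj; case=> -[].
  + case: Ej => Ee; case: El; rewrite Ee => /set2_inj; case=> -[] // /inlI /key E [jl]; move: E; rewrite -jl.
    * by move/same.
    * move=> E; apply: Or42; exists j => //.
      by apply: (addrI (pow4 j.+1)); rewrite -E -dbl_pow4 /dbl /trpl; ring.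
    * move=> E; apply: Or41; exists j => //.
      by apply: (addrI (pow4 j)); rewrite -E -dbl_pow4 /dbl /trpl; ring.
    * by move/same.
Qed.

(** The edge lies in the translates by [x - 4 ^ j] and [x - 4 ^ j.+1], whose shifts differ by a
    reserved element, so no conflict arises. *)
Lemma separates_reserved (F : seq (seq (R + 'I_c)%type)) x (j : 'I_c) :
  (forall i, translate p i \in F) -> separates F [set inl x; inr j].
Proof.
move=> hF; have [s1 s2] := steps_pow4 (ltn_ord j).
have jc : (j <= c)%N by apply: ltnW.
have E1 : [set inl x; inr j] = [set shift (x - pow4 j) (place (pow4 j)); shift (x - pow4 j) (place (dbl (pow4 j)))].
  by rewrite place_inr place_inl ?pow4_not_removed //= addrC subrK.
have E2 : [set inl x; inr j] = [set shift (x - pow4 j.+1) (place (dbl (pow4 j))); shift (x - pow4 j.+1) (place (pow4 j.+1))].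
  by rewrite place_inr place_inl ?pow4_not_removed //= addrC subrK setUC.
have Ed : (x - pow4 j.+1) - (x - pow4 j) = - trpl (pow4 j).
  by rewrite -dbl_pow4 /dbl /trpl; ring.
apply: (separates_two (hF (x - pow4 j)) (hF (x - pow4 j.+1))).
- by rewrite E1; apply: mem_translate.
- by rewrite E2; apply: mem_translate.
move=> f /translate_edge_kind h1 /translate_edge_kind h2.
case: (common_edge _ h1 h2).
- apply/eqP => /addrI /oppr_inj /(pow4_inj jc (ltn_ord j)); exact: n_Sn.
all: rewrite Ed.
- case=> k /esym E _; exfalso; apply: (@pow4_neg k j) => //; first exact: ltnW.
  by apply: trpl_inj; rewrite E /trpl; ring.
- case=> k /oppr_inj /trpl_inj /pow4_inj E ->; have -> : k = j; last by rewrite addrC subrK.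
  by apply/esym/val_inj/E; rewrite // ltnW.
(* Here [a = - 4 ^ j], so [-2a] is the removed vertex [2 * 4 ^ j], contrary to [ha]. *)
- case=> a [E ha _]; case/negP: ha; apply/removedP; exists j; congr dbl.
  by apply: trpl_inj; transitivity (- trpl a); [rewrite /trpl; ring|rewrite -E opprK].
- case=> k kk; case: pL => _ _ _ [_ hD _].
  have [|h1' h2'] := hD k (trpl (pow4 j)) kk.
    by rewrite inE; apply/orP; left; apply/imsetP; exists j.
  have [|h3 h4] := hD k (- trpl (pow4 j)) kk.
    by rewrite inE; apply/orP; right; apply/imsetP; exists j.
  by rewrite opprK => -[] /eqP; rewrite ?(negPf h1') ?(negPf h2') ?(negPf h3) ?(negPf h4).
Qed.

(* The differences [a] for which [{a, 2a}] or [{-a, -2a}] is missing from the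
   path or meets a removed vertex, or for which a shift by [3a] or [-3a] moves
   some link onto a doubling edge. *)
Definition bad : {set R} :=
  [set a | (a, dbl a) \notin steps p] :|: [set a | (- a, dbl (- a)) \notin steps p]
  :|: ([set a | dbl a \in removed] :|: [set a | dbl (- a) \in removed]
     :|: [set a | a \in removed] :|: [set a | - a \in removed])
  :|: ([set a | trpl a \in [seq k.2 - dbl k.1 | k <- ks]] :|: [set a | - trpl a \in [seq k.2 - dbl k.1 | k <- ks]]
     :|: [set a | trpl a \in [seq k.1 - dbl k.2 | k <- ks]] :|: [set a | - trpl a \in [seq k.1 - dbl k.2 | k <- ks]]).

(** With [a = y - x], the edge is the translate of [{a, 2a}] by [x - a] and of [{-a, -2a}] by
    [y + a]. These shifts differ by [3a], and tripling is injective, so no other edge is common to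
    the two translates. *)
Lemma separates_good (F : seq (seq (R + 'I_c)%type)) x y :
  (forall i, translate p i \in F) -> x != y -> y - x \notin bad ->
  separates F [set inl x; inl y].
Proof.
move=> hF xy; set a := y - x; rewrite !in_setU !in_set !negb_or !negbK -!andbA.
move=> /and5P [s1 s2 r1 r2 /and5P [r3 r4 k1 k2 /andP [k3 k4]]].
have E1 : [set inl x; inl y] = [set shift (x - a) (place a); shift (x - a) (place (dbl a))].
  rewrite !place_inl //=; congr [set inl _; inl _]; rewrite /dbl /a; ring.
have E2 : [set inl x; inl y] = [set shift (y + a) (place (- a)); shift (y + a) (place (dbl (- a)))].
  rewrite !place_inl //= setUC; congr [set inl _; inl _]; rewrite /dbl /a; ring.
have Ed : (y + a) - (x - a) = trpl a by rewrite /trpl /a; ring.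
apply: (separates_two (hF (x - a)) (hF (y + a))).
- by rewrite E1; apply: mem_translate.
- by rewrite E2; apply: mem_translate.
move=> f /translate_edge_kind h1 /translate_edge_kind h2.
case: (common_edge _ h1 h2).
- rewrite eq_sym -subr_eq0 Ed; apply: contra xy => /eqP E.
  by rewrite eq_sym -subr_eq0 -/a; apply/eqP/trpl_inj; rewrite E /trpl !addr0.
all: rewrite Ed.
- by case=> j /trpl_inj E _; case/negP: r1; apply/removedP; exists j; rewrite E.
- case=> j E _; case/negP: r2; apply/removedP; exists j; congr dbl.
  by apply: trpl_inj; transitivity (- trpl a); [rewrite /trpl; ring|rewrite E opprK].
- by case=> b [/trpl_inj <- _ ->]; rewrite E1 !place_inl.
- case=> k kk [] E; exfalso.
  + by case/negP: k1; apply/mapP; exists k; rewrite // E addrC addKr.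
  + by case/negP: k2; apply/mapP; exists k; rewrite // E addrC addKr.
  + by case/negP: k3; apply/mapP; exists k; rewrite // E addrC addKr.
  + by case/negP: k4; apply/mapP; exists k; rewrite // E addrC addKr.
Qed.

End Translates.

(** * Counting preimages and edges *)

Lemma card_preim_le (T : finType) (g : T -> T) (P : pred T) :
  injective g -> (#|[set x | P (g x)]| <= #|[set x | P x]|)%N.
Proof.
move=> gi; rewrite -(card_imset _ gi); apply/subset_leq_card/subsetP.
by move=> _ /imsetP [x + ->]; rewrite !inE.
Qed.

Lemma card_preim_seq_le (T : finType) (g : T -> T) (s : seq T) :
  injective g -> (#|[set x | g x \in s]| <= size s)%N.
Proof.
move=> gi; apply: leq_trans (@card_preim_le _ g (fun z => z \in s) gi) _.
by rewrite cardsE card_size.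
Qed.

Lemma card_incident (V : finType) (r : rel V) (H : {set {set V}}) (v : V) :
  symmetric r -> {in H, forall e, exists x y, r x y /\ e = [set x; y]} ->
  (#|[set e in H | v \in e]| <= #|[set w | r v w]|)%N.
Proof.
move=> rS hH; apply: leq_trans (leq_imset_card (fun w => [set v; w]) _).
apply/subset_leq_card/subsetP => e; rewrite inE => /andP [/hH [x [y [rxy ->]]]].
rewrite !inE => /orP [] /eqP ->; apply/imsetP; [exists y|exists x] => //.
- by rewrite inE.
- by rewrite inE rS.
- by rewrite setUC.
Qed.

(** Double counting of incidences, with the factor 2 given away. *)
Lemma card_graph_le (V : finType) (H : {set {set V}}) (D : nat) :
  (forall e, e \in H -> #|e| == 2) ->
  (forall v, #|[set e in H | v \in e]| <= D)%N -> (#|H| <= #|V| * D)%N.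
Proof.
move=> h2 hD; rewrite -sum1_card.
apply: leq_trans (_ : \sum_(e in H) \sum_(v : V) (v \in e) <= _)%N.
  apply: leq_sum => e /h2 /eqP E; apply: leq_trans (_ : #|e| <= _)%N; first by rewrite E.
  by rewrite -sum1_card big_mkcond; apply: leq_sum => v _; case: (v \in e).
rewrite exchange_big /= -sum_nat_const; apply: leq_sum => v _.
apply: leq_trans (hD v); rewrite -sum1_card [leqLHS]big_mkcond [leqRHS]big_mkcond.
by apply: leq_sum => e _; rewrite inE; case: (e \in H); case: (v \in e).
Qed.

Lemma leq_cardU (T : finType) (A B : {set T}) (a b : nat) :
  (#|A| <= a -> #|B| <= b -> #|A :|: B| <= a + b)%N.
Proof. by move=> hA hB; apply: leq_trans (leq_card_setU _ _) (leq_add hA hB). Qed.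

(** * The separating family: translates together with paths for the spoiled edges *)

Section Family.
Variables (R : finComNzRingType) (c : nat).
Notation dbl := (@dbl R).
Notation pow4 := (@pow4 R).
Notation trpl := (@trpl R).
Hypothesis dbl_inj : injective dbl.
Hypothesis trpl_inj : injective trpl.
Hypothesis pow4_inj : forall i j, (i <= c)%N -> (j <= c)%N -> pow4 i = pow4 j -> i = j.
Hypothesis pow4_neg : forall i j, (i <= c)%N -> (j <= c)%N -> pow4 i <> - pow4 j.
Hypothesis pow4_dbl : forall i j, (i < c)%N -> (j <= c)%N -> dbl (pow4 i) <> pow4 j.

(** A union bound over the ten sets that make up [bad], each handled as a preimage under an
    injective map. *)
Lemma card_bad p ks :
  (#|bad c p ks| <= 2 * #|[set a | (a, dbl a) \notin steps p]| + 4 * c + 4 * size ks)%N.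
Proof.
have oi : injective (-%R : R -> R) := oppr_inj.
have cr : (#|removed R c| <= c)%N by rewrite /removed; apply: leq_trans (leq_imset_card _ _) _; rewrite card_ord.
have crE : #|[set x | x \in removed R c]| = #|removed R c| by rewrite cardsE.
have sz (f : R * R -> R) : size ks = size (map f ks) by rewrite size_map.
rewrite /bad; apply: leq_cardU; first apply: leq_cardU.
- rewrite mul2n -addnn; apply: leq_trans (leq_card_setU _ _) _; rewrite leq_add2l.
  exact: (@card_preim_le R -%R (fun a => (a, dbl a) \notin steps p)).
- have h (g : R -> R) : injective g -> (#|[set x | g x \in removed R c]| <= c)%N.
    by move=> gi; apply: leq_trans (@card_preim_le _ g (fun z => z \in removed R c) gi) _; rewrite crE.
  rewrite (_ : 4 * c = c + c + c + c)%N; last by lia.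
  apply: leq_cardU; first apply: leq_cardU; first apply: leq_cardU.
  + exact: h.
  + by apply: (h (dbl \o -%R)); apply: inj_comp.
  + exact: (h id).
  + exact: h.
- rewrite (_ : 4 * size ks = size ks + size ks + size ks + size ks)%N; last by lia.
  apply: leq_cardU; first apply: leq_cardU; first apply: leq_cardU.
  + by rewrite [leqRHS](sz (fun k => k.2 - dbl k.1)); apply: card_preim_seq_le.
  + rewrite [leqRHS](sz (fun k => k.2 - dbl k.1)).
    by apply: (@card_preim_seq_le _ (-%R \o trpl)); apply: inj_comp.
  + by rewrite [leqRHS](sz (fun k => k.1 - dbl k.2)); apply: card_preim_seq_le.
  + rewrite [leqRHS](sz (fun k => k.1 - dbl k.2)).
    by apply: (@card_preim_seq_le _ (-%R \o trpl)); apply: inj_comp.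
Qed.

Lemma pow4_in_orbit j : pow4 j \in orbit dbl 1.
Proof.
elim: j => [|j IH]; first by rewrite /pow4 expr0 -fconnect_orbit connect0.
by rewrite -dbl_pow4; do 2!apply: orbit_dbl_closed.
Qed.

Lemma dbl_last_orbit (x : R) : dbl (last x (orbit dbl x)) = x.
Proof.
have := cycle_orbit dbl_inj x; have [s [-> _]] := orbit_cons x.
by rewrite /= rcons_path => /andP [_ /eqP].
Qed.

Lemma steps_orbit (x y : R) : y \in orbit dbl x -> dbl y != x ->
  (y, dbl y) \in steps (orbit dbl x).
Proof.
have := dbl_last_orbit x; have [s [-> hs]] := orbit_cons x => hl yo dy.
have [|b hb] := steps_succ yo; first by apply: contraNneq dy => ->; apply/eqP.
by rewrite -(fpath_steps hs hb).
Qed.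

(** The greedy construction starts with the orbit of 1, which contains all removed vertices and
    their neighbours. *)
Lemma base_path L : exists p ks,
  [/\ linked (reserved R c) L p ks,
      {in ks, forall k, (k.1 \notin removed R c) && (k.2 \notin removed R c)},
      (forall j, (j < c)%N -> (pow4 j, dbl (pow4 j)) \in steps p /\ (dbl (pow4 j), pow4 j.+1) \in steps p)
    & (#|bad c p ks| <=
       10 * size ks + 12 * c + 2 * #|[set x | order dbl x < L]| + 2)%N].
Proof.
have pow0 : pow4 0 = 1 by [].
have neq1 j : (j < c)%N -> dbl (dbl (pow4 j)) != 1.
  by move=> jc; rewrite dbl_pow4 -pow0; apply/eqP => /(pow4_inj jc (leq0n _)).
have [||p [ks [hl sp kr p0 le]]] := @greedy_linked R dbl_inj (reserved R c) L (removed R c) 1.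
- by move=> x /removedP [j ->]; apply: orbit_dbl_closed (pow4_in_orbit j).
(* The double of the last vertex of the orbit is 1; if that vertex were [2 * 4 ^ j], then [4 ^ j.+1]
   would be 1. *)
- apply/removedP => -[j E]; have := neq1 j (ltn_ord j).
  by rewrite -E dbl_last_orbit eqxx.
exists p, ks; split=> // [j jc|].
  split; apply: sp.
    apply: steps_orbit (pow4_in_orbit j) _.
    by rewrite -pow0; apply/eqP/pow4_dbl.
  by rewrite -dbl_pow4; apply: steps_orbit (neq1 _ jc); apply: orbit_dbl_closed (pow4_in_orbit j).
have cr : (#|reserved R c| <= 2 * c)%N.
  rewrite mul2n -addnn; apply: leq_trans (leq_card_setU _ _) _.
  by apply: leq_add; apply: leq_trans (leq_imset_card _ _) _; rewrite card_ord.
have h1 := card_bad p ks; have h2 := card_not_doubled hl p0.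
by lia.
Qed.

Lemma translates_family L s : (0 < s)%N ->
  exists (D : nat) (F : seq (seq (R + 'I_c)%type)),
  [/\ {in F, forall t, uniq t}, (forall x y, x != y -> separates F [set x; y]),
      (L * D <= 20 * #|R| + L * (25 * c + 4 * #|[set x | order dbl x < L]| + 4))%N
    & (size F <= #|R| + 2 * (4 * D + ((#|R| + c) * D) %/ s + s + 2))%N].
Proof.
move=> s0; have [p [ks [hl kr st cb]]] := base_path L.
(* The edges left to the sparse part: those with a bad difference and those between two fixed
   points. *)
pose r (u v : (R + 'I_c)%type) := match u, v with
  | inl x, inl y => (y - x \in bad c p ks) || (x - y \in bad c p ks)
  | inr _, inr _ => true
  | _, _ => false end.
have rS : symmetric r by move=> [x|i] [y|j] //=; rewrite orbC.
pose H : {set {set (R + 'I_c)%type}} :=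
  [set [set e.1; e.2] | e : ((R + 'I_c) * (R + 'I_c))%type & (e.1 != e.2) && r e.1 e.2].
have h2 e : e \in H -> #|e| == 2.
  by case/imsetP => -[u v]; rewrite inE /= => /andP [uv _] ->; rewrite cards2 uv.
have hr : {in H, forall e, exists x y, r x y /\ e = [set x; y]}.
  by move=> e /imsetP [[u v]]; rewrite inE /= => /andP [_ uv] ->; exists u, v.
pose D := (2 * #|bad c p ks| + c)%N.
have hD v : (#|[set e in H | v \in e]| <= D)%N.
  apply: leq_trans (card_incident v rS hr) _.
  case: v => [x|i].
    pose B := [set y | y - x \in bad c p ks] :|: [set y | x - y \in bad c p ks].
    apply: leq_trans (_ : #|[set (inl y : (R + 'I_c)%type) | y in B]| <= _)%N.
      apply/subset_leq_card/subsetP => -[y|j]; rewrite inE //= => h.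
      by apply/imsetP; exists y => //; move: h; rewrite /B; move: (bad c p ks) => S; rewrite !inE.
    apply: leq_trans (leq_imset_card _ _) _; apply: leq_trans (leq_card_setU _ _) _.
    rewrite /D mul2n -addnn -[leqLHS]addn0 leq_add // leq_add //.
      apply: leq_trans (@card_preim_le _ (fun y => y - x) (fun z => z \in bad c p ks) _) _.
        exact: addIr.
      by rewrite cardsE.
    apply: leq_trans (@card_preim_le _ (fun y => x - y) (fun z => z \in bad c p ks) _) _.
      by move=> a b /addrI /oppr_inj.
    by rewrite cardsE.
  apply: leq_trans (_ : #|[set (inr j : (R + 'I_c)%type) | j : 'I_c]| <= _)%N.
    apply/subset_leq_card/subsetP => -[y|j]; rewrite inE //= => _.
    by apply/imsetP; exists j.
  by apply: leq_trans (leq_imset_card _ _) _; rewrite card_ord leq_addl.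
have [F1 [uF1 sF1 pF1]] := separate_sparse h2 hD s0 (leqnn _) (leqnn _).
pose F0 := [seq translate c p i | i <- enum R].
have hF i : translate c p i \in F0 ++ F1.
  by rewrite mem_cat map_f // mem_enum.
exists D, (F0 ++ F1); split.
- move=> t; rewrite mem_cat => /orP [/mapP [i _ ->]|/uF1 //].
  rewrite map_inj_uniq; first by case: hl.
  by move=> x y /shift_inj /(place_inj dbl_inj pow4_inj).
- move=> u v uv; have [ruv|] := boolP (r u v).
    have eH : [set u; v] \in H by apply/imsetP; exists (u, v); rewrite // inE uv.
    by move=> f fe; have [t tF tP] := pF1 _ eH f fe; exists t; rewrite // mem_cat tF orbT.
  case: u v uv => [x|i] [y|j] //= uv.
  + rewrite negb_or => /andP [h _]; by apply: separates_good h => //; exact: hl.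
  + by move=> _; apply: (@separates_reserved R) => //; first exact: hl.
  + by move=> _; rewrite setUC; apply: (@separates_reserved R) => //; first exact: hl.
(* Since [L * size ks] is at most [#|R|], the summand [20 * size ks] of the bound on [D] contributes
   [20 * #|R|] after multiplication by [L]. *)
- have [hu _ _ [_ _ hL]] := hl.
  have : (size p <= #|R|)%N.
    by rewrite cardE; apply: uniq_leq_size hu _ => x; rewrite mem_enum.
  rewrite /D; nia.
- rewrite size_cat size_map -cardE sF1 leq_add2l leq_mul2l /=.
  have : (#|H| %/ s <= (#|R| + c) * D %/ s)%N.
    by apply: leq_div2r; have := card_graph_le h2 hD; rewrite card_sum card_ord.
  by lia.
Qed.

End Family.

(** * Integers modulo m *)

Lemma iter_dbl (R : finComNzRingType) (x : R) (l : nat) : iter l (@dbl R) x = x *+ (2 ^ l).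
Proof. by elim: l => [|l IH] //=; rewrite IH /dbl -mulrnDr addnn -mul2n expnS. Qed.

Section Zm.
Variable m : nat.
Hypothesis m1 : (1 < m)%N.
Local Notation R := 'Z_m.

Lemma Zm_nat_eq0 (k : nat) : (k%:R == 0 :> R) = (m %| k)%N.
Proof. by rewrite -val_eqE /= val_Zp_nat. Qed.

Lemma Zm_nat_inj (a b : nat) : (a < m)%N -> (b < m)%N -> a%:R = b%:R :> R -> a = b.
Proof. by move=> am bm /(congr1 val) /=; rewrite !val_Zp_nat // !modn_small. Qed.

(** A solution [x] is determined by the quotient of [K * x] by [m], which is less than [K]. *)
Lemma card_Zm_torsion (K : nat) : (0 < K)%N -> (#|[set x : R | (x *+ K == 0)%R]| <= K)%N.
Proof.
move=> K0; have lt x : (K * (x : R) %/ m < K)%N.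
  rewrite ltn_divLR ?(ltnW m1) // ltn_pmul2l //.
  by apply: leq_trans (ltn_ord x) _; rewrite Zp_cast.
rewrite -[leqRHS]card_ord -(@card_in_imset _ _ (fun x => Ordinal (lt x))); first exact: max_card.
have dv x : x \in [set x : R | (x *+ K == 0)%R] -> (m %| K * x)%N.
  by rewrite inE -Zm_nat_eq0 natrM mulr_natl natr_Zp.
move=> x y /dv hx /dv hy [E]; apply/val_inj/eqP.
by rewrite -(eqn_pmul2l K0) -(divnK hx) -(divnK hy) E.
Qed.

(** An orbit of length [l] consists of solutions of [(2 ^ l - 1) x = 0], of which there are fewer
    than [2 ^ l]; summing over [l < L] gives the bound. *)
Lemma card_short_orbits (L : nat) : injective (@dbl R) ->
  (#|[set x : R | order (@dbl R) x < L]| <= 2 ^ L)%N.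
Proof.
move=> di; elim: L => [|L IH]; first by rewrite (_ : [set _ | _] = set0) ?cards0 //; apply/setP => x; rewrite !inE.
rewrite expnS mul2n -addnn.
apply: leq_trans (leq_cardU IH (_ : #|[set x : R | (0 < L)%N && (x *+ (2 ^ L - 1) == 0)%R]| <= 2 ^ L)%N).
  apply/subset_leq_card/subsetP => x; rewrite !inE ltnS leq_eqVlt => /orP [/eqP E|->] //.
  have E0 := order_gt0 (@dbl R) x; apply/orP; right; rewrite -E E0 /=.
  by rewrite mulrnBr ?expn_gt0 // -iter_dbl iter_order // subrr.
case: L {IH} => [|L]; first by rewrite (_ : [set _ | _] = set0) ?cards0 //; apply/setP => x; rewrite !inE.
have h : (0 < 2 ^ L.+1 - 1)%N by rewrite subn_gt0 -{1}(expn0 2) ltn_exp2l.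
apply: leq_trans (leq_subr 1 _); apply: leq_trans (card_Zm_torsion h).
by apply/subset_leq_card/subsetP => x; rewrite !inE => /andP [].
Qed.

Lemma Zm_family (c L s : nat) : m = 1 %[mod 6] -> (2 * 4 ^ c < m)%N -> (0 < s)%N ->
  exists (D : nat) (F : seq (seq (R + 'I_c)%type)),
  [/\ {in F, forall t, uniq t}, (forall x y, x != y -> separates F [set x; y]),
      (L * D <= 20 * m + L * (25 * c + 4 * 2 ^ L + 4))%N
    & (size F <= m + 2 * (4 * D + ((m + c) * D) %/ s + s + 2))%N].
Proof.
move=> m6 cm s0.
(* As [6k = -1] in the ring, [-3k] and [-2k] are the inverses of 2 and 3. *)
have [k mk] : exists k, m = (6 * k + 1)%N by exists (m %/ 6)%N; lia.
have m0 : (6 * k)%:R = -1 :> R.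
  by apply/eqP; rewrite -subr_eq0 opprK -[1]/(1%:R) -natrD Zm_nat_eq0 -mk.
have dblK (x : R) : - (3 * k)%:R * dbl x = x.
  by transitivity (- (6 * k)%:R * x); [rewrite /dbl !natrM; ring|rewrite m0; ring].
have trplK (x : R) : - (2 * k)%:R * trpl x = x.
  by transitivity (- (6 * k)%:R * x); [rewrite /trpl !natrM; ring|rewrite m0; ring].
have dbl_inj : injective (@dbl R) := can_inj dblK.
have trpl_inj : injective (@trpl R) := can_inj trplK.
have pE j : pow4 R j = (4 ^ j)%:R by rewrite natrX.
have lt4 j : (j <= c)%N -> (4 ^ j <= 4 ^ c)%N by move=> jc; rewrite leq_exp2l.
have [|||D [F [h1 h2 h3 h4]]] := @translates_family R c dbl_inj trpl_inj _ _ _ L s s0.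
- move=> i j /lt4 ic /lt4 jc; rewrite !pE => /Zm_nat_inj E.
  by apply/eqP; rewrite -(@eqn_exp2l 4) //; apply/eqP/E; lia.
- move=> i j /lt4 ic /lt4 jc; rewrite !pE => /eqP; rewrite -subr_eq0 opprK -natrD Zm_nat_eq0.
  move/dvdn_leq; rewrite addn_gt0 expn_gt0 => /(_ isT); lia.
- move=> i j /ltnW /lt4 ic /lt4 jc; rewrite /dbl !pE -natrD => /Zm_nat_inj E.
  (* Both sides are below [m], so the equation holds in the integers, where the parity of the
     exponents contradicts it. *)
  have {}E : (2 ^ (2 * i + 1) = 2 ^ (2 * j))%N.
    by rewrite expnD !expnM (_ : 2 ^ 2 = 4)%N //; lia.
  by move/eqP: E; rewrite eqn_exp2l //; lia.
rewrite card_ord Zp_cast // in h3 h4.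
exists D, F; split=> //; apply: leq_trans h3 _.
by rewrite leq_add2l leq_mul2l !leq_add2r leq_add2l leq_mul2l /= card_short_orbits ?orbT.
Qed.

End Zm.

(** * Choice of parameters and the asymptotic statement *)

Lemma ssp_K_upper (q : nat) : (0 < q)%N -> exists N : nat, forall n : nat, (N <= n)%N ->
  (q * ssp_K n <= q.+1 * n)%N.
Proof.
suff H r : (0 < r)%N -> exists N : nat, forall n : nat, (N <= n)%N ->
    (r * ssp_K n <= (r + 220) * n)%N.
  move=> q0; have [|N hN] := H (220 * q)%N; first by rewrite muln_gt0.
  exists N => n /hN; rewrite -mulnSr -!mulnA leq_pmul2l //.
(* With [L = q ^ 2] and [s] about [n / q], both [q * D] and [q * (n * D %/ s)] are at most [L * D],
   hence at most [21 * n]. *)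
move: r => {}q q0; set L := (q * q)%N.
set B := (L * (25 * 6 + 4 * 2 ^ L + 4))%N.
(* The summand 3000 ensures [m > 2 * 4 ^ 5 = 2048], and [B] absorbs the terms that do not grow with
   [n]. *)
exists (q + 3000 + B)%N => n hn.
set c := ((n - 1) %% 6)%N; set m := (6 * ((n - 1) %/ 6) + 1)%N.
have nE : n = (m + c)%N by rewrite /m /c; lia.
have c6 : (c < 6)%N by rewrite /c ltn_mod.
have m1 : (1 < m)%N by lia.
have m6 : m = 1 %[mod 6] by rewrite /m; lia.
have c4 : (2 * 4 ^ c < m)%N.
  by apply: leq_ltn_trans (_ : 2 * 4 ^ 5 < m)%N; [rewrite leq_mul2l leq_exp2l //|rewrite (_ : 2 * 4 ^ 5 = 2048)%N //; lia].
set s := (n %/ q + 1)%N; have s0 : (0 < s)%N by rewrite /s; lia.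
have [D [F [uF sF hD hF]]] := Zm_family m1 L m6 c4 s0.
have cV : #|{: 'Z_m + 'I_c}| = n by rewrite card_sum !card_ord Zp_cast.
have le : (ssp_K n <= size F)%N := ssp_K_le cV uF sF.
apply: leq_trans (leq_mul (leqnn q) (leq_trans le hF)) _.
rewrite -nE.
have hc : (L * (25 * c + 4 * 2 ^ L + 4) <= B)%N.
  by rewrite /B leq_mul2l; apply/orP; right; lia.
have LD : (L * D <= 21 * n)%N by lia.
have qs : (n < q * s)%N by rewrite /s addn1 mulnC -ltn_divLR.
have q1 : (q * (n %/ q) <= n)%N by rewrite mulnC leq_trunc_div.
have hs : ((n * D) %/ s <= q * D)%N.
  rewrite -(@leq_pmul2r s) //; apply: leq_trans (leq_trunc_div _ _) _.
  by rewrite mulnAC leq_mul2r (ltnW qs) orbT.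
have qqs : (q * ((n * D) %/ s) <= L * D)%N by rewrite /L -mulnA leq_mul2l hs orbT.
have qD : (q * D <= L * D)%N by rewrite leq_mul2r /L leq_pmulr ?orbT.
have qs2 : (q * s <= n + q)%N by rewrite /s mulnDr muln1 leq_add2r.
have qn : (q <= n)%N by lia.
have mn : (q * m <= q * n)%N by rewrite leq_mul2l nE leq_addr orbT.
(* The excess over [q * n] is at most [2 * (84 + 21 + 2 + 2) * n = 218 * n]. *)
rewrite mulnDr mulnCA !mulnDr mulnDl; lia.
Qed.

(* ssp(K_n) = (1 + o(1)) n as n -> oo. *)
Theorem theorem1p1 :
  forall eps : rat, 0 < eps ->
  exists N : nat, forall n : nat, (N <= n)%N ->
    (1 - eps) * n%:R <= (ssp_K n)%:R <= (1 + eps) * n%:R.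
Proof.
(* This choice gives [1 / q < eps]. *)
move=> eps eps0; pose q := Num.bound eps^-1.
have qe : 1 < q%:R * eps.
  by rewrite -ltr_pdivrMr // div1r archi_boundP // invr_ge0 ltW.
have q0 : (0 < q)%N.
  by rewrite lt0n; apply: contraTneq qe => ->; rewrite mul0r ltr10.
have [N hN] := ssp_K_upper q0.
exists (N + 3)%N => n hn; apply/andP; split.
  apply: le_trans (_ : n%:R <= _); last by rewrite ler_nat ssp_K_ge //; lia.
  by rewrite ler_piMl ?ler0n // gerBl ltW.
have /hN : (N <= n)%N by lia.
rewrite -(ler_nat rat) !natrM -addn1 natrD => h.
rewrite -(@ler_pM2l _ q%:R) ?ltr0n //; apply: le_trans h _.
by rewrite mulrA ler_wpM2r ?ler0n // mulrDr mulr1 lerD2l ltW.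
Qed.
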